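(* For $\delta\le 0$ define $$\eta^L(\delta)=\max\Big\{g\Big(\delta+\sum_{i\in S_0^+\cup\{s\}}a_ix_i\Big)-\sum_{i\in S_0^+}\zeta(a_i)x_i+(k-x_s)\rho_s(k)-g(ka_s) : x_i\in\mathbb{Z},\ 0\le x_i\le\mu_i\ \forall\, i\in S_0^+\cup\{s\}\Big\},$$ $$\eta^U(\delta)=\max\Big\{g\Big(\delta+\sum_{i\in S_0\cup\{s\}}a_ix_i\Big)-\sum_{i\in S_0}\zeta(a_i)x_i+(k-x_s)\rho_s(k)-g(ka_s) : x_i\in\mathbb{Z}\ \forall\, i\in S_0\cup\{s\},\ 0\le x_i\le\mu_i\ \forall\, i\in S_0,\ x_s\ge 0\Big\}.$$ Both $\eta^L$ and $\eta^U$ are subadditive on $\mathbb{R}_-=(-\infty,0]$.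
   Context: Let $n\ge 1$, let $f:\mathbb{R}\to\mathbb{R}$ be concave, let $a\in\mathbb{R}^n$ with $a_i\ge 0$ for all $i$, and let $\mu\in\mathbb{Z}^n$ with all $\mu_i\ge 1$. Fix $s\in\{1,\dots,n\}$ with $a_s>0$, disjoint subsets $S_0,S_1$ of $\{1,\dots,n\}\setminus\{s\}$ with $\{s\}\cup S_0\cup S_1=\{1,\dots,n\}$, and an integer $k\in\{1,\dots,\mu_s\}$. Define $g(z)=f\big(z+\sum_{i\in S_1}\mu_i a_i\big)$, $\rho_s(k)=g(ka_s)-g((k-1)a_s)$, $$\zeta(\delta)=\max\big\{g(\delta+a_s x)-\rho_s(k)(x-k)-g(ka_s) : x\in\mathbb{Z},\ 0\le x\le\mu_s\big\}\quad(\delta\in\mathbb{R}),$$ and $S_0^+=\{i\in S_0 : a_i\ge ka_s\}$. A function $h$ is subadditive on $D$ if $h(\delta_1)+h(\delta_2)\ge h(\delta_1+\delta_2)$ for all $\delta_1,\delta_2\in D$ with $\delta_1+\delta_2\in D$. *)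

(* Defs.v *)
From mathcomp Require Import all_boot all_order all_algebra.
From mathcomp Require Import boolp classical_sets reals.
From mathcomp Require Import ring lra zify.

Set Implicit Arguments.
Unset Strict Implicit.
Unset Printing Implicit Defensive.

Import Order.TTheory GRing.Theory Num.Theory.
Local Open Scope classical_set_scope.
Local Open Scope ring_scope.

Definition concave (R : realType) (f : R -> R) : Prop :=
  forall x y t : R, 0 <= t <= 1 ->
    t * f x + (1 - t) * f y <= f (t * x + (1 - t) * y).

Definition subadditive_on (R : realType) (D : set R) (h : R -> R) : Prop :=
  forall d1 d2 : R, D d1 -> D d2 -> D (d1 + d2) -> h (d1 + d2) <= h d1 + h d2.

Definition is_max (R : realType) (A : set R) (m : R) : Prop :=
  A m /\ ubound A m.

(* The greatest element of [A], with the junk value 0 if there is none.  The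
   maxima defining [zeta], [etaL] and [etaU] are attained: see [zetaP], [etaLP]
   and [etaUP]. *)
Definition max_set (R : realType) (A : set R) : R := xget 0 (is_max A).

Section Lifting.
Context (R : realType) (n : nat) (f : R -> R) (a : 'I_n -> R) (mu : 'I_n -> int).
Context (s : 'I_n) (S0 S1 : {set 'I_n}) (k : int).

Definition g (z : R) : R := f (z + \sum_(i in S1) (mu i)%:~R * a i).

Definition rho : R := g (k%:~R * a s) - g ((k - 1)%:~R * a s).

Definition zeta (delta : R) : R :=
  max_set [set g (delta + a s * x%:~R) - rho * (x - k)%:~R - g (k%:~R * a s)
          | x in [set x : int | 0 <= x <= mu s]].

Definition S0plus : {set 'I_n} := [set i in S0 | k%:~R * a s <= a i]%SET.

(* Only the values of [x] on [s |: S] matter here. *)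
Definition eta_obj (S : {set 'I_n}) (delta : R) (x : 'I_n -> int) : R :=
  g (delta + \sum_(i in s |: S) a i * (x i)%:~R)
  - \sum_(i in S) zeta (a i) * (x i)%:~R
  + (k - x s)%:~R * rho - g (k%:~R * a s).

Definition etaL (delta : R) : R :=
  max_set [set eta_obj S0plus delta x
          | x in [set x : 'I_n -> int |
                   forall i, i \in s |: S0plus -> 0 <= x i <= mu i]].

Definition etaU (delta : R) : R :=
  max_set [set eta_obj S0 delta x
          | x in [set x : 'I_n -> int |
                   (forall i, i \in S0 -> 0 <= x i <= mu i) /\ 0 <= x s]].

End Lifting.

Lemma max_setP (R : realType) (A : set R) (m : R) :
  is_max A m -> is_max A (max_set A).
Proof. by move=> Am; rewrite /max_set; apply: xgetPex; exists m. Qed.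

Lemma max_set_finite (R : realType) (T : Type) (I : finType) (A : set T)
    (F : T -> R) (P : pred I) (h : I -> T) (t0 : T) :
  A t0 -> (forall i, P i -> A (h i)) ->
  (forall t, A t -> exists2 i, P i & F t <= F (h i)) ->
  is_max [set F t | t in A] (max_set [set F t | t in A]).
Proof.
move=> At0 PA dom; have [i0 Pi0 _] := dom _ At0.
have [i Pi imax] := arg_maxP (fun i => F (h i)) Pi0.
apply: (@max_setP _ _ (F (h i))); split; first by exists (h i) => //; apply: PA.
move=> _ [t At <-]; have [j Pj le_tj] := dom _ At.
exact: le_trans le_tj (imax _ Pj).
Qed.

Lemma concave_slope (R : realType) (f : R -> R) (x y h : R) :
  concave f -> x <= y -> 0 <= h -> f (y + h) - f y <= f (x + h) - f x.
Proof.
move=> fc xy h0; have [yx0|yxN0] := eqVneq (y - x + h) 0.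
  have -> : y = x by lra.
  by [].
have yx0 : 0 < y - x + h by rewrite lt_neqAle eq_sym yxN0; lra.
pose t := h / (y - x + h).
have t01 : 0 <= t <= 1.
  by rewrite /t ler_pdivrMr // mul1r divr_ge0 //=; lra.
have := fc x (y + h) t t01; have := fc (y + h) x t t01.
have -> : t * x + (1 - t) * (y + h) = y by rewrite /t; field.
have -> : t * (y + h) + (1 - t) * x = x + h by rewrite /t; field.
lra.
Qed.

Section Attained.
Context (R : realType) (n : nat) (f : R -> R) (a : 'I_n -> R) (mu : 'I_n -> int).
Context (s : 'I_n) (S0 S1 : {set 'I_n}) (k : int).
Hypothesis mu_ge1 : forall i, 1 <= mu i.

Lemma zetaP (delta : R) :
  let A := [set g f a mu S1 (delta + a s * x%:~R) - rho f a mu s S1 k * (x - k)%:~R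
                - g f a mu S1 (k%:~R * a s)
           | x in [set x : int | 0 <= x <= mu s]] in
  is_max A (zeta f a mu s S1 k delta).
Proof.
have mus := mu_ge1 s.
apply: (@max_set_finite _ _ 'I_(`|mu s|.+1) _ _ xpredT (fun i => i%:Z) 0).
- by rewrite /=; lia.
- by move=> i _ /=; have := ltn_ord i; lia.
- move=> x /= x01; have lt_x : (`|x| < `|mu s|.+1)%N by lia.
  by exists (Ordinal lt_x) => //=; have -> : Posz `|x| = x by lia.
Qed.

Lemma eta_obj_eq (S : {set 'I_n}) (delta : R) (x y : 'I_n -> int) :
  {in s |: S, x =1 y} ->
  eta_obj f a mu s S1 k S delta x = eta_obj f a mu s S1 k S delta y.
Proof.
move=> xy; rewrite /eta_obj (xy s) ?setU11//.
congr (g _ _ _ _ (_ + _) - _ + _ - _); apply: eq_bigr => i iS; rewrite xy//.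
exact: setU1r.
Qed.

Lemma eta_box_max (S : {set 'I_n}) (delta : R) (b : 'I_n -> int)
    (A : set ('I_n -> int)) :
  (forall i, 0 <= b i) ->
  (forall x, (forall i, i \in s |: S -> 0 <= x i <= b i) -> A x) ->
  (forall x, A x -> exists2 y, (forall i, i \in s |: S -> 0 <= y i <= b i) &
     eta_obj f a mu s S1 k S delta x <= eta_obj f a mu s S1 k S delta y) ->
  let B := [set eta_obj f a mu s S1 k S delta x | x in A] in
  is_max B (max_set B).
Proof.
move=> b0 bA Ab; pose M := (\sum_i `|b i|)%N.
have bM i : (`|b i| <= M)%N by rewrite /M (bigD1 i)//= leq_addr.
apply: (@max_set_finite _ _ {ffun 'I_n -> 'I_M.+1} _ _
  (fun w => [forall i in s |: S, (w i)%:Z <= b i]) (fun w i => (w i)%:Z)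
  (fun=> 0)).
- by apply: bA => i _; rewrite lexx b0.
- by move=> w /forall_inP wb; apply: bA => i iS; rewrite wb.
- move=> x /Ab[y yb le_xy].
  have yE i : i \in s |: S -> (@inord M `|y i|)%:Z = y i.
    move=> iS; have := yb i iS; have := bM i => bMi yi.
    by rewrite inordK; lia.
  exists [ffun i => inord `|y i|].
    by apply/forall_inP => i iS; rewrite ffunE yE//; case/andP: (yb i iS).
  apply: (le_trans le_xy); rewrite le_eqVlt; apply/orP; left; apply/eqP.
  by apply: eta_obj_eq => i iS; rewrite ffunE yE.
Qed.

Lemma etaLP (delta : R) :
  let A := [set eta_obj f a mu s S1 k (S0plus a s S0 k) delta x
           | x in [set x : 'I_n -> int |
                    forall i, i \in s |: S0plus a s S0 k -> 0 <= x i <= mu i]] in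
  is_max A (etaL f a mu s S0 S1 k delta).
Proof.
apply: (@eta_box_max _ _ mu) => //.
- by move=> i; have := mu_ge1 i; lia.
- by move=> x xb; exists x.
Qed.

Hypothesis fc : concave f.
Hypothesis a_ge0 : forall i, 0 <= a i.
Hypothesis as_gt0 : 0 < a s.
Hypothesis sS0 : s \notin S0.

Lemma eta_obj_decr (delta : R) (x : 'I_n -> int) (j : int) :
  (forall i, i \in S0 -> 0 <= x i) -> (k - 1)%:~R - delta / a s <= j%:~R ->
  let upd m := fun i => if i == s then m else x i in
  eta_obj f a mu s S1 k S0 delta (upd (j + 1)) <=
  eta_obj f a mu s S1 k S0 delta (upd j).
Proof.
move=> x0 jbig /=; rewrite /eta_obj !big_setU1//= !eqxx.
have updS m (c : 'I_n -> R) :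
    \sum_(i in S0) c i * (if i == s then m else x i)%:~R
    = \sum_(i in S0) c i * (x i)%:~R.
  by apply: eq_bigr => i iS; case: eqP => // is_; case/negP: (sS0); rewrite -is_.
rewrite !updS; set Z := \sum_(i in S0) zeta _ _ _ _ _ _ _ * _.
set T := \sum_(i in S0) _ * _.
have T0 : 0 <= T.
  by apply: sumr_ge0 => i iS; rewrite mulr_ge0// ler0z x0.
have le1 : (k - 1)%:~R * a s <= delta + (a s * j%:~R + T).
  have : ((k - 1)%:~R - delta / a s) * a s <= j%:~R * a s by rewrite ler_pM2r.
  by rewrite mulrBl divfK ?gt_eqF//; lra.
pose c := \sum_(i in S1) (mu i)%:~R * a i.
have := @concave_slope _ f ((k - 1)%:~R * a s + c)
  (delta + (a s * j%:~R + T) + c) (a s) fc.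
rewrite lerD2r le1 => /(_ isT (ltW as_gt0)).
rewrite /rho /g -/c.
have -> : delta + (a s * (j + 1)%:~R + T) + c
        = delta + (a s * j%:~R + T) + c + a s by rewrite rmorphD /=; ring.
have -> : k%:~R * a s + c = (k - 1)%:~R * a s + c + a s.
  by rewrite rmorphB /=; ring.
rewrite !rmorphB !rmorphD /=; lra.
Qed.

Lemma etaUP (delta : R) :
  let A := [set eta_obj f a mu s S1 k S0 delta x
           | x in [set x : 'I_n -> int |
                    (forall i, i \in S0 -> 0 <= x i <= mu i) /\ 0 <= x s]] in
  is_max A (etaU f a mu s S0 S1 k delta).
Proof.
pose K := Num.max 0 (Num.ceil ((k - 1)%:~R - delta / a s)).
have K0 : 0 <= K by rewrite le_max lexx.
have KP : (k - 1)%:~R - delta / a s <= K%:~R.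
  by apply: (le_trans (Num.Theory.ceil_ge _)); rewrite ler_int le_max lexx orbT.
have neq_s i : i \in S0 -> (i == s) = false.
  by move=> iS; apply/eqP => is_; case/negP: (sS0); rewrite -is_.
apply: (@eta_box_max _ _ (fun i => if i == s then K else mu i)).
- by move=> i; case: ifP => // _; have := mu_ge1 i; lia.
- move=> x xb; split=> [i iS|].
    by have := xb i; rewrite neq_s// => -> //; apply: setU1r.
  by have := xb s; rewrite setU11 eqxx => /(_ isT) /andP[].
move=> x [xS xs0]; have [xsK|Kxs] := leP (x s) K.
  exists x => // i; rewrite in_setU1; have [-> _|_ /= /xS//] := eqVneq i s.
  by rewrite xs0.
pose upd m i := if i == s then m else x i.
exists (upd K) => [i|].
  rewrite in_setU1 /upd; have [-> _|_ /= /xS//] := eqVneq i s.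
  by rewrite K0 lexx.
have -> : eta_obj f a mu s S1 k S0 delta x
        = eta_obj f a mu s S1 k S0 delta (upd (K + `|x s - K|%N%:Z)).
  apply: eta_obj_eq => i _; rewrite /upd; have [->|//] := eqVneq i s; lia.
elim: `|_|%N => [|m IHm]; first by rewrite addr0.
apply: le_trans IHm; have -> : K + m.+1%:Z = K + m%:Z + 1 by lia.
apply: eta_obj_decr => [i /xS/andP[]//|].
by apply: (le_trans KP); rewrite ler_int; lia.
Qed.

End Attained.

(* Main.v *)
Require Import Defs.
From mathcomp Require Import all_boot all_order all_algebra.
From mathcomp Require Import boolp classical_sets reals.
From mathcomp Require Import ring lra zify.
Import Order.TTheory GRing.Theory Num.Theory.
Local Open Scope ring_scope.

(** Translate [g] by [k * a_s] and subtract its chord of slope [rho / a_s]: the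
    result [phi] is concave and vanishes at [0] and at [- a_s], and up to a term
    linear in [delta] the objective becomes
    [phi (delta + sum a_i x_i + a_s m) - sum z_i x_i] with [m = x_s - k >= - k].
    Dropping an item with [a_i < k a_s] and shifting [m] accordingly loses
    nothing, so only [S0plus] matters.

    Given an optimal [x] for [u + v] with [u, v <= 0], hand items to [u] until the
    next item [i] would make its subtotal positive; the items after [i] go to [v].
    If [i] does not exist, both subtotals are nonpositive.  If the subtotal of [v]
    is nonpositive, both sides receive a copy of [i]: the bounds on [x_i] apply to
    each side separately, and a copy pays because [z_i <= phi (a_i - k a_s)].
    Otherwise [u] receives [i] and both subtotals are positive.  In each case [m]
    can be split so that concavity or unimodality of [phi] gives the inequality. *)

(** * Concave functions with zeros at [0] and [- a] *)

Section ConcaveTwoZeros.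
Context (R : realType) (phi : R -> R) (a : R).
Hypothesis phi_concave : concave phi.
Hypothesis a_gt0 : 0 < a.
Hypothesis phi0 : phi 0 = 0.
Hypothesis phiNa : phi (- a) = 0.

(** The points [p] and [q] lie between [w] and [c] with the same sum, so a pair is moved inwards: a
    step of length [p - w] gains at least as much from [w] as from [q]. *)
Lemma concave_swap (w c p q : R) :
  w <= p -> w <= q -> p + q = w + c -> phi w + phi c <= phi p + phi q.
Proof.
move=> wp wq pqE; have h0 : 0 <= p - w by lra.
have := concave_slope phi_concave wq h0.
have -> : q + (p - w) = c by lra.
have -> : w + (p - w) = p by lra.
lra.
Qed.

Lemma phi_ge0 (x : R) : - a <= x <= 0 -> 0 <= phi x.
Proof.
have a0 := a_gt0.
move=> xa; pose t := - x / a.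
have t01 : 0 <= t <= 1.
  by rewrite /t ler_pdivlMr // ler_pdivrMr //; lra.
have := phi_concave (- a) 0 t t01; rewrite phiNa phi0.
have -> : t * (- a) + (1 - t) * 0 = x by rewrite /t; field; rewrite gt_eqF.
lra.
Qed.

Lemma phi_le0_pos (x : R) : 0 <= x -> phi x <= 0.
Proof.
have a0 := a_gt0.
move=> x0; have xa : 0 < x + a by lra.
pose t := x / (x + a).
have t01 : 0 <= t <= 1 by rewrite /t ler_pdivlMr // ler_pdivrMr //; lra.
have := phi_concave (- a) x t t01; rewrite phiNa.
have -> : t * (- a) + (1 - t) * x = 0 by rewrite /t; field; rewrite gt_eqF.
have t1 : 0 < 1 - t.
  have -> : 1 - t = a / (x + a) by rewrite /t; field; rewrite gt_eqF.
  exact: divr_gt0.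
by rewrite phi0 mulr0 add0r pmulr_rle0.
Qed.

Lemma phi_le0_neg (x : R) : x <= - a -> phi x <= 0.
Proof.
have a0 := a_gt0.
move=> xa; pose t := a / - x.
have x0 : 0 < - x by lra.
have t01 : 0 <= t <= 1 by rewrite /t ler_pdivlMr // ler_pdivrMr //; lra.
have := phi_concave x 0 t t01; rewrite phi0.
have -> : t * x + (1 - t) * 0 = - a by rewrite /t; field; rewrite lt_eqF //; lra.
have t0 : 0 < t by exact: divr_gt0.
by rewrite phiNa mulr0 addr0 pmulr_rle0.
Qed.

(** For [x <= 0] the two values are separated by [0]. For [x > 0] the point [x] lies between [0] and
    [w], so [phi x] is at least a fraction [t <= 1] of the nonpositive [phi w]. *)
Lemma phi_le_right (x w : R) : - a <= x <= w -> 0 <= w -> phi w <= phi x.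
Proof.
have a0 := a_gt0.
move=> xw w0; have w_le0 := phi_le0_pos _ w0.
have [x0|x0] := leP x 0; first by apply: (le_trans w_le0); apply: phi_ge0; lra.
have wgt0 : 0 < w by lra.
pose t := x / w.
have t01 : 0 <= t <= 1 by rewrite /t ler_pdivlMr // ler_pdivrMr //; lra.
have := phi_concave w 0 t t01; rewrite phi0.
have -> : t * w + (1 - t) * 0 = x by rewrite /t; field; rewrite gt_eqF.
nra.
Qed.

Lemma phi_le_left (x w : R) : w <= x <= 0 -> w <= - a -> phi w <= phi x.
Proof.
have a0 := a_gt0.
move=> wx wa; have w_le0 := phi_le0_neg _ wa.
have [xa|xa] := leP (- a) x.
  by apply: (le_trans w_le0); apply: phi_ge0; lra.
have wlt0 : 0 < - w by lra.
pose t := - x / - w.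
have t01 : 0 <= t <= 1 by rewrite /t ler_pdivlMr // ler_pdivrMr //; lra.
have := phi_concave w 0 t t01; rewrite phi0.
have -> : t * w + (1 - t) * 0 = x by rewrite /t; field; rewrite lt_eqF //; lra.
nra.
Qed.

(** The exchange is made with the pair [w, 0] here and with [- a, w] in the next lemma; the zeros of
    [phi] make the added point free. The remainders [w - r] and [w - r - a] differ by one [a], so
    both correspond to integer shifts. *)
Lemma phi_split_at_le (r w : R) : - a <= r <= 0 -> w <= r ->
  phi w <= phi r + phi (w - r).
Proof.
move=> ra wr; have := @concave_swap w 0 r (w - r); rewrite phi0 !addr0 => h.
by apply: h; lra.
Qed.

Lemma phi_split_at_gt (r w : R) : - a <= r <= 0 -> r <= w ->
  phi w <= phi r + phi (w - r - a).
Proof.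
move=> ra wr; have := @concave_swap (- a) w r (w - r - a); rewrite phiNa add0r => h.
by apply: h; lra.
Qed.

(** * Shifts by integer multiples of [a] *)

Lemma exists_shift (u : R) : exists j : int, - a < u + a * j%:~R <= 0.
Proof.
have a0 := a_gt0.
exists (Num.floor (- u / a)).
have := floor_le_tmp (- u / a); have := floorD1_gt (- u / a).
rewrite ltr_pdivrMr // ler_pdivlMr // rmorphD /= => h1 h2; lra.
Qed.

Lemma shift_lt (i j : int) : a * i%:~R < a * j%:~R + a -> i <= j.
Proof.
have -> : a * j%:~R + a = a * (j + 1)%:~R by rewrite rmorphD /=; ring.
by rewrite ltr_pM2l // ltr_int; lia.
Qed.

Lemma shift_le (i j : int) : i <= j -> a * i%:~R <= a * j%:~R.
Proof. by move=> ij; rewrite ler_pM2l // ler_int. Qed.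

(** * Splitting an argument with shifts confined to [[- k, M]] *)

Context (k M : int).
Hypothesis k_ge1 : 1 <= k.
Hypothesis M_ge0 : 0 <= M.

(** Since [k >= 1], both arguments are at most [- a], where [phi] is nondecreasing; a shift below
    [- k] can thus be raised to [- k]. *)
Lemma shift_into_left (v : R) (j : int) : v <= 0 -> j < - k ->
  phi (v + a * j%:~R) <= phi (v + a * (- k)%:~R).
Proof.
have a0 := a_gt0.
move=> v0 jk; have := shift_le j (- k) (ltW jk).
have kN1 : - k <= -1 by lia.
have := shift_le _ _ kN1; rewrite mulrN1 => h1 h2.
by apply: phi_le_left; lra.
Qed.

(** The first part [u + a * j] lies where [phi] is nonnegative; the rest is [v] shifted by [m - j]
    or [m - j - 1]. As [j >= 0], neither shift exceeds [M], and clipping mends a shift below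
    [- k]. *)
Lemma split_neg_aux (u v : R) (m j : int) : u <= 0 -> v <= 0 ->
  - k <= m <= M -> - a < u + a * j%:~R <= 0 -> j <= M ->
  exists m1 m2 : int, [/\ - k <= m1 <= M, - k <= m2 <= M &
    phi (u + v + a * m%:~R) <= phi (u + a * m1%:~R) + phi (v + a * m2%:~R)].
Proof.
have a0 := a_gt0.
move=> u0 v0 mM jP jM; have j0 : 0 <= j.
  by apply: shift_lt; lra.
set w := u + v + _; exists j.
pose clip m2 := if m2 < - k then - k else m2.
have clipP m2 : m2 <= M -> - k <= clip m2 <= M /\
    phi (v + a * m2%:~R) <= phi (v + a * (clip m2)%:~R).
  rewrite /clip; case: ltP => [/(shift_into_left _ _ v0) le m2M|le m2M].
    by split => //; lia.
  by split => //; lia.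
have [wj|wj] := leP w (u + a * j%:~R).
  exists (clip (m - j)); have [|cb cle] := clipP (m - j); first lia.
  split=> //; first lia.
  apply: le_trans (phi_split_at_le (u + a * j%:~R) w _ wj) _; first lra.
  rewrite lerD2l; apply: le_trans cle; rewrite le_eqVlt; apply/orP; left.
  by apply/eqP; congr phi; rewrite rmorphB /= /w; ring.
exists (clip (m - j - 1)); have [|cb cle] := clipP (m - j - 1); first lia.
split=> //; first lia.
apply: le_trans (phi_split_at_gt (u + a * j%:~R) w _ (ltW wj)) _; first lra.
rewrite lerD2l; apply: le_trans cle; rewrite le_eqVlt; apply/orP; left.
by apply/eqP; congr phi; rewrite !rmorphB /= /w; ring.
Qed.

Lemma split_neg (u v : R) (m : int) : u <= 0 -> v <= 0 -> - k <= m <= M ->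
  exists m1 m2 : int, [/\ - k <= m1 <= M, - k <= m2 <= M &
    phi (u + v + a * m%:~R) <= phi (u + a * m1%:~R) + phi (v + a * m2%:~R)].
Proof.
have a0 := a_gt0.
move=> u0 v0 mM; have [i iP] := exists_shift u; have [j jP] := exists_shift v.
have [iM|Mi] := leP i M; first exact: (split_neg_aux _ _ _ i).
have [jM|Mj] := leP j M.
  have [m2 [m1 [h2 h1 le]]] := split_neg_aux _ _ _ _ v0 u0 mM jP jM.
  by exists m1, m2; split=> //; rewrite (addrC u) addrC [leRHS]addrC addrC.
(* Both windows need shifts above [M], so at shift [M] both arguments are at most [- a]. As
   [m <= M + M], the target lies left of their sum, on the nondecreasing branch. *)
exists M, M; split; [lia|lia|].
have {}Mi : M + 1 <= i by lia.
have {}Mj : M + 1 <= j by lia.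
have := shift_le _ _ Mi; have := shift_le _ _ Mj.
have mM' : m <= M + M by lia.
have := shift_le _ _ mM'; rewrite !rmorphD /= => h1 h2 h3.
have := @concave_swap (u + a * M%:~R + (v + a * M%:~R)) 0
  (u + a * M%:~R) (v + a * M%:~R); rewrite phi0 !addr0 => h.
apply: le_trans (h _ _ erefl); try lra.
by apply: phi_le_left; lra.
Qed.

Lemma shift_neg (t : R) (l : int) : 0 < t -> t + a * l%:~R <= 0 -> l < 0.
Proof.
move=> t0 tl; rewrite -[l < 0](ltr_int R) -(ltr_pM2l a_gt0) mulr0; lra.
Qed.

Lemma exists_shift_or_extremal (t : R) : 0 < t ->
  exists2 l : int, - k <= l <= M &
    - a <= t + a * l%:~R <= 0 \/ l = - k /\ 0 < t + a * l%:~R.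
Proof.
move=> t0; have [l lP] := exists_shift t.
have l0 : l < 0 by apply: (shift_neg t) => //; lra.
have [kl|lk] := leP (- k) l; first by exists l; [lia|left; lra].
exists (- k); first by lia.
have {}lk : l + 1 <= - k by lia.
have := shift_le _ _ lk; rewrite rmorphD /= => h.
by right; split=> //; lra.
Qed.

(** Positive [u] and [v] call for shifts at most [0], so the bound [M] is respected. If [w < 0],
    split at the window point of [u]. If [w >= 0], then [phi w <= 0], and each side is either in the
    window, where [phi >= 0], or held at shift [- k] with a positive argument. *)
Lemma split_pos (u v : R) (m : int) : 0 < u -> 0 < v -> - k <= m ->
  exists m1 m2 : int, [/\ - k <= m1 <= M, - k <= m2 <= M &
    phi (u + v + a * m%:~R) <= phi (u + a * m1%:~R) + phi (v + a * m2%:~R)].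
Proof.
have a0 := a_gt0; have mk0 : - k <= 0 by lia.
move=> u0 v0 km; set w := u + v + _.
have [w0|w0] := ltP w 0.
  have [i iP] := exists_shift u.
  have iN : i < 0 by apply: (shift_neg u) => //; lra.
  have im : m <= i by apply: shift_lt; rewrite /w in w0; lra.
  exists i.
  have [wi|wi] := leP w (u + a * i%:~R).
    have E : w - (u + a * i%:~R) = v + a * (m - i)%:~R.
      by rewrite /w rmorphB /=; ring.
    have mi : m - i < 0 by apply: (shift_neg v) => //; lra.
    exists (m - i); split; [lia|lia|].
    by rewrite -E; apply: phi_split_at_le => //; lra.
  have E : w - (u + a * i%:~R) - a = v + a * (m - i - 1)%:~R.
    by rewrite /w !rmorphB /=; ring.
  exists (m - i - 1); split; [lia| |].
    have mi : m - i - 1 < 0 by apply: (shift_neg v) => //; lra.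
    by lia.
  by rewrite -E; apply: phi_split_at_gt; lra.
have [m1 m1b m1P] := exists_shift_or_extremal u u0.
have [m2 m2b m2P] := exists_shift_or_extremal v v0.
have hm := shift_le _ _ km.
have hk := shift_le _ _ mk0; rewrite mulr0 in hk.
exists m1, m2; split=> //.
have w_le0 := phi_le0_pos _ w0.
case: m1P m2P => [pb|[m1E pp]] [qb|[m2E qp]].
- have := phi_ge0 _ pb; have := phi_ge0 _ qb; lra.
- suff : phi w <= phi (v + a * m2%:~R) by have := phi_ge0 _ pb; lra.
  by apply: phi_le_right => //; rewrite m2E /w in qp *; lra.
- suff : phi w <= phi (u + a * m1%:~R) by have := phi_ge0 _ qb; lra.
  by apply: phi_le_right => //; rewrite m1E /w in pp *; lra.
(* Both sides are held at shift [- k]. Their sum is at most [w] because [- k - k <= - k <= m]. *)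
have := @concave_swap 0 (u + a * m1%:~R + (v + a * m2%:~R))
  (u + a * m1%:~R) (v + a * m2%:~R); rewrite phi0 !add0r => h.
apply: le_trans (h _ _ erefl); try lra.
by apply: phi_le_right; [rewrite m1E m2E /w in pp qp *; lra|lra].
Qed.

(** With [b = c - k * a], each side is [b] plus [u] or [v] plus a nonnegative shift. If
    [m + k <= i + j], then [m + k] is divided so that both sides stay at most [b], and the pair
    [w, b] is exchanged. Otherwise both sides take their window shifts and land in [(b - a, b]]. *)
Lemma split_duplicate (u v c : R) (m : int) : u <= 0 -> v <= 0 ->
  k%:~R * a <= c -> - k <= m <= M ->
  exists m1 m2 : int, [/\ - k <= m1 <= M, - k <= m2 <= M &
    phi (u + v + c + a * m%:~R) + phi (c - k%:~R * a) <=
    phi (u + c + a * m1%:~R) + phi (v + c + a * m2%:~R)].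
Proof.
have a0 := a_gt0.
move=> u0 v0 kc mM; set w := u + v + _ + _; set b := c - _.
have b0 : 0 <= b by rewrite /b; lra.
have [i iP] := exists_shift u; have [j jP] := exists_shift v.
have i0 : 0 <= i by apply: shift_lt; lra.
have j0 : 0 <= j by apply: shift_lt; lra.
have [mij|ijm] := leP (m + k) (i + j).
  pose i' := Num.min i (m + k); pose j' := m + k - i'.
  have i'b : 0 <= i' <= i /\ i' <= m + k by rewrite /i'; lia.
  have j'b : 0 <= j' <= j by rewrite /j' /i'; lia.
  exists (i' - k), (j' - k); split; [lia|lia|].
  have [/andP[_ /shift_le hi] _] := i'b; case/andP: j'b => _ /shift_le hj.
  have hs : a * i'%:~R + a * j'%:~R = a * m%:~R + a * k%:~R.
    by rewrite /j' rmorphB rmorphD /=; ring.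
  by apply: concave_swap; rewrite ?rmorphB /= /w /b; lra.
exists (i - k), (j - k); split; [lia|lia|].
set p := u + c + _; set q := v + c + _.
have pE : p = b + (u + a * i%:~R) by rewrite /p /b rmorphB /=; ring.
have qE : q = b + (v + a * j%:~R) by rewrite /q /b rmorphB /=; ring.
move: ijm; rewrite -lezD1 => ijm.
have := shift_le _ _ ijm; rewrite !rmorphD /= => hm.
have wE : w = b + (u + v) + (a * m%:~R + a * k%:~R) by rewrite /w /b; ring.
have pw : b - a < p <= b by lra.
have qw : b - a < q <= b by lra.
have wpq : p + q + a <= w + b by lra.
have phib := phi_le0_pos _ b0.
have phip : phi b <= phi p by apply: phi_le_right; lra.
have phiq : phi b <= phi q by apply: phi_le_right; lra.
(* Both values on the right dominate [phi b], so for [w >= 0] it suffices that one of them dominates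
   [phi w]. *)
have [w0|w0] := leP 0 w.
  have [pw'|wp] := leP p w.
    suff : phi w <= phi p by lra.
    by apply: phi_le_right; lra.
  suff : phi w <= phi q by lra.
  by apply: phi_le_right; lra.
(* A negative [w] forces [m + k = i + j + 1] and [b < a]. Hence [p + q = (b - a) + w], and
   [phi (b - a) >= 0 >= phi b]. *)
have {}ijm : m + k <= i + j + 1.
  have [//|{}ijm] := leP (m + k) (i + j + 1).
  move: ijm; rewrite -lezD1 => ijm.
  by have := shift_le _ _ ijm; rewrite !rmorphD /=; lra.
have := shift_le _ _ ijm; rewrite !rmorphD /= => hm'.
have := @concave_swap (b - a) w p q.
have := phi_ge0 (b - a).
lra.
Qed.
End ConcaveTwoZeros.

(** * Choosing items one copy at a time *)

Lemma sum_add_item (R : realType) (I : finType) (S : {set I}) (F : I -> R)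
    (y : I -> int) (i : I) : i \in S ->
  \sum_(j in S) F j * (y j + Posz (j == i))%:~R =
  \sum_(j in S) F j * (y j)%:~R + F i.
Proof.
move=> iS; under eq_bigr do rewrite rmorphD mulrDr /=.
rewrite big_split /=; congr (_ + _).
rewrite (bigD1 i) //= eqxx mulr1 big1 ?addr0 // => j /andP[_ /negPf->].
by rewrite mulr0.
Qed.

(** Copies are removed from [x] one by one until the subtotal is nonpositive; the copy removed last
    is the crossing item [i]. The induction is on the total number of copies. *)
Lemma last_nonpos_subtotal (R : realType) (I : finType) (S : {set I})
    (c : I -> R) (x : I -> int) (u : R) : u <= 0 ->
  (forall i, i \in S -> 0 <= x i) ->
  u + \sum_(i in S) c i * (x i)%:~R <= 0 \/
  exists y i, [/\ i \in S,
    forall j, j \in S -> 0 <= y j /\ y j + Posz (j == i) <= x j &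
    u + \sum_(j in S) c j * (y j)%:~R <= 0 <
    u + \sum_(j in S) c j * (y j)%:~R + c i].
Proof.
move=> u0; have [N] := ubnP (\sum_(i in S) `|x i|)%N.
elim: N x => // N IH x xN x0.
have [|pos] := leP (u + \sum_(i in S) c i * (x i)%:~R) 0; first by left.
have [i iS xi] : exists2 i, i \in S & x i != 0.
  apply/exists_inP; apply: contraLR pos; rewrite negb_exists_in => /forall_inP x00.
  rewrite big1 ?addr0 -?leNgt // => i iS.
  by have := x00 i iS; rewrite negbK => /eqP->; rewrite mulr0.
pose x' j := x j - Posz (j == i).
have x'E j : x j = x' j + Posz (j == i) by rewrite /x'; lia.
have x'0 j : j \in S -> 0 <= x' j.
  move=> jS; have := x0 j jS; rewrite /x'; have [->|_] := eqVneq j i; last by lia.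
  by move: xi => /eqP; lia.
have x'N : (\sum_(j in S) `|x' j| < N)%N.
  rewrite ltnS in xN; apply: leq_trans xN.
  rewrite (bigD1 i) //= [leqRHS](bigD1 i) //= -addSn.
  have xi0 := x'0 i iS; apply: leq_add.
    by move: xi0; rewrite /x' eqxx; lia.
  by apply: leq_sum => j /andP[_ /negPf ji]; rewrite /x' ji subr0.
right; have [x'neg|[y [i' [i'S yP yc]]]] := IH x' x'N x'0.
  exists x', i; split => // [j jS|].
    by split; [exact: x'0 | rewrite -x'E].
  rewrite x'neg -addrA -sum_add_item //=.
  by under eq_bigr do rewrite -x'E.
exists y, i'; split => // j jS; have [y0 yx] := yP j jS; split => //.
by apply: (le_trans yx); rewrite /x'; lia.
Qed.

(** * Absorbing small items and distributing large ones *)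

Section Items.
Context (R : realType) (phi : R -> R) (a : R) (k : int).
Hypothesis phi_concave : concave phi.
Hypothesis a_gt0 : 0 < a.
Hypothesis phi0 : phi 0 = 0.
Hypothesis phiNa : phi (- a) = 0.
Hypothesis k_ge1 : 1 <= k.

(** An item of size [c] and price [z] can be removed without loss after changing the shift. The
    bound [- k] encodes [x_s >= 0]; the new shift has no upper bound, which suits [etaU]. *)
Definition absorbable (c z : R) : Prop := forall (w : R) (m : int), - k <= m ->
  exists2 m' : int, - k <= m' & phi (w + c + a * m%:~R) - z <= phi (w + a * m'%:~R).

Lemma absorbable0 : absorbable 0 0.
Proof. by move=> w m km; exists m => //; rewrite addr0 subr0. Qed.

Lemma absorbableD (c1 z1 c2 z2 : R) :
  absorbable c1 z1 -> absorbable c2 z2 -> absorbable (c1 + c2) (z1 + z2).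
Proof.
move=> h1 h2 w m km; have [m2 km2 le2] := h2 (w + c1) m km.
have [m1 km1 le1] := h1 w m2 km2; exists m1 => //.
by rewrite addrA; lra.
Qed.

Lemma absorbableMz (c z : R) (x : int) :
  0 <= x -> absorbable c z -> absorbable (c * x%:~R) (z * x%:~R).
Proof.
case: x => // n _ h; elim: n => [|n IH].
  by rewrite !mulr0; exact: absorbable0.
rewrite -addn1 PoszD rmorphD /= !mulrDr !mulr1.
exact: absorbableD.
Qed.

(** As [c < k * a], some [t] in [[1, k]] puts [r = c - a * t] in [[- a, 0]]. Splitting at [r] leaves
    [w] shifted by [m + t] or [m + t - 1], and the price covers [phi r]. *)
Lemma absorbable_small (c z : R) : 0 <= c < k%:~R * a ->
  (forall t : int, 1 <= t <= k -> phi (c - a * t%:~R) <= z) -> absorbable c z.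
Proof.
move=> cb zP w m km; have a0 := a_gt0.
have [j jP] := exists_shift _ _ a_gt0 c.
have j0 : j <= 0 by apply: (shift_lt _ _ a_gt0); lra.
(* [1 <= t] keeps [m + t - 1 >= - k]; hence the shift 1, not 0, at [c = 0] *)
pose t := if j == 0 then 1 else - j.
have tP : - a <= c - a * t%:~R <= 0.
  rewrite /t; case: eqP jP => [->|_]; first by rewrite mulr0 mulr1; lra.
  by rewrite rmorphN /=; lra.
have t1 : 1 <= t by rewrite /t; case: eqP => //; lia.
have tk : t <= k.
  rewrite /t; case: eqP => // _.
  apply: (shift_lt _ _ a_gt0); rewrite rmorphN /=; lra.
have {zP} zt : phi (c - a * t%:~R) <= z by apply: zP; rewrite t1 tk.
set r := c - _ in tP zt; set W := w + c + _.
have [Wr|Wr] := leP W r.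
  exists (m + t); first by lia.
  have -> : w + a * (m + t)%:~R = W - r by rewrite /W /r rmorphD /=; ring.
  have := phi_split_at_le _ _ _ phi_concave phi0 r W tP Wr; lra.
exists (m + t - 1); first by lia.
have -> : w + a * (m + t - 1)%:~R = W - r - a.
  by rewrite /W /r rmorphB rmorphD /=; ring.
have := phi_split_at_gt _ _ _ phi_concave phiNa r W tP (ltW Wr); lra.
Qed.

Lemma absorbable_sum (I : finType) (S : {set I}) (c z : I -> R) (x : I -> int) :
  (forall i, i \in S -> 0 <= x i) ->
  (forall i, i \in S -> 0 <= c i < k%:~R * a) ->
  (forall i, i \in S -> forall t : int, 1 <= t <= k ->
     phi (c i - a * t%:~R) <= z i) ->
  absorbable (\sum_(i in S) c i * (x i)%:~R) (\sum_(i in S) z i * (x i)%:~R).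
Proof.
move=> x0 cP zP; apply: (big_ind2 absorbable); first exact: absorbable0.
  by move=> c1 z1 c2 z2; exact: absorbableD.
move=> i iS; apply: absorbableMz; first exact: x0.
by apply: absorbable_small; [exact: cP|exact: zP].
Qed.

Context (M : int) (I : finType) (S : {set I}) (c z : I -> R).
Hypothesis M_ge0 : 0 <= M.
Hypothesis c_large : forall i, i \in S -> k%:~R * a <= c i.
Hypothesis z_le : forall i, i \in S -> z i <= phi (c i - k%:~R * a).

Lemma split_items (u v : R) (x : I -> int) (m : int) : u <= 0 -> v <= 0 ->
  (forall i, i \in S -> 0 <= x i) -> - k <= m <= M ->
  exists y1 y2 m1 m2,
  [/\ forall i, i \in S -> 0 <= y1 i <= x i,
      forall i, i \in S -> 0 <= y2 i <= x i,
      - k <= m1 <= M, - k <= m2 <= M &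
    phi (u + v + \sum_(i in S) c i * (x i)%:~R + a * m%:~R)
      - \sum_(i in S) z i * (x i)%:~R <=
    (phi (u + \sum_(i in S) c i * (y1 i)%:~R + a * m1%:~R)
      - \sum_(i in S) z i * (y1 i)%:~R) +
    (phi (v + \sum_(i in S) c i * (y2 i)%:~R + a * m2%:~R)
      - \sum_(i in S) z i * (y2 i)%:~R)].
Proof.
move=> u0 v0 x0 mM.
have [neg|[y [i [iS yP /andP[yneg ypos]]]]] := last_nonpos_subtotal _ _ _ c _ _ u0 x0.
  have [m1 [m2 [m1b m2b le]]] :=
    split_neg _ _ _ phi_concave a_gt0 phi0 phiNa _ _ k_ge1 M_ge0 _ _ _ neg v0 mM.
  have sum0 (F : I -> R) : \sum_(i in S) F i * 0%:~R = 0.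
    by rewrite big1 // => *; rewrite mulr0.
  exists x, (fun=> 0), m1, m2; split => //.
    by move=> i iS; rewrite lexx x0.
  by rewrite !sum0 addr0 subr0 [u + v + _]addrAC; lra.
(* [x1] ends with the crossing copy of [i], [x2] is the rest starting with that copy, and [x3] the
   rest after it. So [x1] and [x2] share the copy, yet neither exceeds [x]. *)
pose x1 j := y j + Posz (j == i); pose x2 j := x j - y j.
pose x3 j := x j - x1 j.
have sumE (F : I -> R) : \sum_(j in S) F j * (x j)%:~R =
    \sum_(j in S) F j * (y j)%:~R + \sum_(j in S) F j * (x3 j)%:~R + F i.
  rewrite addrAC -sum_add_item // -big_split /=; apply: eq_bigr => j _.
  by rewrite /x3 /x1 rmorphB /=; ring.
have sum1 (F : I -> R) : \sum_(j in S) F j * (x1 j)%:~R =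
    \sum_(j in S) F j * (y j)%:~R + F i by exact: sum_add_item.
have sum2 (F : I -> R) : \sum_(j in S) F j * (x2 j)%:~R =
    \sum_(j in S) F j * (x3 j)%:~R + F i.
  rewrite -sum_add_item //; apply: eq_bigr => j _; congr (_ * _%:~R).
  by rewrite /x2 /x3 /x1; lia.
have x1b j : j \in S -> 0 <= x1 j <= x j.
  by move=> jS; have [] := yP j jS; rewrite /x1; lia.
have x2b j : j \in S -> 0 <= x2 j <= x j.
  by move=> jS; have [] := yP j jS; rewrite /x2; lia.
have x3b j : j \in S -> 0 <= x3 j <= x j.
  by move=> jS; have [] := yP j jS; rewrite /x3 /x1; lia.
set Y := \sum_(j in S) c j * (y j)%:~R in yneg ypos.
pose T := \sum_(j in S) c j * (x3 j)%:~R.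
have [vneg|vpos] := leP (v + T) 0.
  have [m1 [m2 [m1b m2b le]]] := split_duplicate _ _ _ phi_concave a_gt0 phi0
    phiNa _ _ k_ge1 M_ge0 _ _ (c i) _ yneg vneg (c_large _ iS) mM.
  exists x1, x2, m1, m2; split => //.
  rewrite !sumE !sum1 !sum2 -/Y -/T; have := z_le _ iS.
  have -> : u + v + (Y + T + c i) = u + Y + (v + T) + c i by ring.
  by rewrite !addrA in le *; lra.
have [m1 [m2 [m1b m2b le]]] := split_pos _ _ _ phi_concave a_gt0 phi0
  phiNa _ _ k_ge1 M_ge0 _ _ m ypos vpos (proj1 (andP mM)).
exists x1, x3, m1, m2; split => //.
rewrite !sumE !sum1 -/Y -/T.
have -> : u + v + (Y + T + c i) = u + Y + c i + (v + T) by ring.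
by rewrite !addrA in le *; lra.
Qed.
End Items.

Lemma concave_shift_sub_linear (R : realType) (f : R -> R) (c d r : R) :
  concave f -> concave (fun t => f (t + c) - d - r * t).
Proof.
move=> fc x y t t01; have := fc (x + c) (y + c) t t01.
have -> : t * (x + c) + (1 - t) * (y + c) = t * x + (1 - t) * y + c by ring.
lra.
Qed.

Lemma sum_update_out (R : realType) (I : finType) (S : {set I}) (s : I)
    (F : I -> R) (y : I -> int) (j : int) : s \notin S ->
  \sum_(i in S) F i * (if i == s then j else y i)%:~R =
  \sum_(i in S) F i * (y i)%:~R.
Proof.
move=> sS; apply: eq_bigr => i iS; case: eqP => // is_.
by case/negP: sS; rewrite -is_.
Qed.

(** * Reduction of [etaL] and [etaU] to the tilted function *)

Section Eta.
Context (R : realType) (n : nat) (f : R -> R) (a : 'I_n -> R) (mu : 'I_n -> int).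
Context (s : 'I_n) (S0 S1 : {set 'I_n}) (k : int).
Hypothesis f_concave : concave f.
Hypothesis a_ge0 : forall i, 0 <= a i.
Hypothesis mu_ge1 : forall i, 1 <= mu i.
Hypothesis as_gt0 : 0 < a s.
Hypothesis sS0 : s \notin S0.
Hypothesis k_bounds : 1 <= k <= mu s.

Notation g := (g f a mu S1).
Notation rho := (rho f a mu s S1 k).
Notation zeta := (zeta f a mu s S1 k).
Notation S0p := (S0plus a s S0 k).
Notation eta_obj := (eta_obj f a mu s S1 k).

(* The centre and the slope are chosen so that it vanishes at 0 and [- a s]. *)
Definition tilted_g (t : R) : R :=
  g (t + k%:~R * a s) - g (k%:~R * a s) - rho / a s * t.

(** Tilting [g] removes [rho / a s * a i] per copy of item [i], so its price is lowered by the same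
    amount. *)
Definition tilted_zeta (i : 'I_n) : R := zeta (a i) - rho / a s * a i.

Lemma tilted_g_concave : concave tilted_g.
Proof.
move=> x y t t01; rewrite /tilted_g /g.
pose c := k%:~R * a s + \sum_(i in S1) (mu i)%:~R * a i.
have := concave_shift_sub_linear _ _ c (g (k%:~R * a s)) (rho / a s)
  f_concave x y t t01.
by rewrite /c !addrA.
Qed.

Lemma tilted_g0 : tilted_g 0 = 0.
Proof. by rewrite /tilted_g add0r mulr0 subrr subr0. Qed.

Lemma tilted_gNa : tilted_g (- a s) = 0.
Proof.
rewrite /tilted_g mulrN divfK ?gt_eqF // opprK /rho.
have -> : - a s + k%:~R * a s = (k - 1)%:~R * a s by rewrite rmorphB /=; ring.
ring.
Qed.

Lemma zeta_objE (d : R) (x : int) :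
  g (d + a s * x%:~R) - rho * (x - k)%:~R - g (k%:~R * a s) =
  rho / a s * d + tilted_g (d + a s * (x - k)%:~R).
Proof.
rewrite /tilted_g.
have -> : d + a s * (x - k)%:~R + k%:~R * a s = d + a s * x%:~R.
  by rewrite rmorphB /=; ring.
by field; rewrite gt_eqF.
Qed.

(** In this form [x s] enters only through the shift [x s - k], and the term [rho / a s * d] is
    additive in [d], so only the bracket has to be split. *)
Lemma eta_objE (S : {set 'I_n}) (d : R) (x : 'I_n -> int) : s \notin S ->
  eta_obj S d x = rho / a s * d +
    (tilted_g (d + \sum_(i in S) a i * (x i)%:~R + a s * (x s - k)%:~R)
     - \sum_(i in S) tilted_zeta i * (x i)%:~R).
Proof.
move=> sS; rewrite /eta_obj big_setU1 //= /tilted_g.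
have -> : \sum_(i in S) tilted_zeta i * (x i)%:~R =
    \sum_(i in S) zeta (a i) * (x i)%:~R
    - rho / a s * \sum_(i in S) a i * (x i)%:~R.
  rewrite mulr_sumr -sumrB; apply: eq_bigr => i _.
  by rewrite /tilted_zeta mulrBl mulrA.
set T := \sum_(i in S) a i * _.
have -> : d + T + a s * (x s - k)%:~R + k%:~R * a s = d + (a s * (x s)%:~R + T).
  by rewrite rmorphB /=; ring.
by rewrite !rmorphB /=; field; rewrite gt_eqF.
Qed.

(** The point [x = k - t] competes in the maximum defining [zeta (a i)], since
    [1 <= t <= k <= mu s]. *)
Lemma tilted_g_le_zeta (i : 'I_n) (t : int) : 1 <= t <= k ->
  tilted_g (a i - a s * t%:~R) <= tilted_zeta i.
Proof.
move=> tk; have [_ ub] := zetaP f a s S1 k mu_ge1 (a i).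
have /ub : [set g (a i + a s * x%:~R) - rho * (x - k)%:~R - g (k%:~R * a s)
    | x in [set x : int | 0 <= x <= mu s]]%classic
    (rho / a s * a i + tilted_g (a i - a s * t%:~R)).
  exists (k - t) => /=; first by lia.
  rewrite zeta_objE; congr (_ + tilted_g (_ + _)).
  by rewrite !rmorphB /=; ring.
rewrite /tilted_zeta; lra.
Qed.

(** A maximiser [x >= 0] puts the argument at or to the right of [a i - k * a s >= 0], where
    [tilted_g] is nonincreasing, so the value at [x = 0] bounds the maximum. *)
Lemma tilted_zeta_le (i : 'I_n) : k%:~R * a s <= a i ->
  tilted_zeta i <= tilted_g (a i - k%:~R * a s).
Proof.
move=> kai; have [[x /= /andP[x0 _] zE] _] := zetaP f a s S1 k mu_ge1 (a i).
rewrite /tilted_zeta -zE zeta_objE [X in X - _]addrC addrK.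
have ax0 : 0 <= a s * x%:~R by rewrite mulr_ge0 ?ler0z // ltW.
apply: (phi_le_right _ _ _ tilted_g_concave as_gt0 tilted_g0 tilted_gNa);
  rewrite ?rmorphB /=; have := as_gt0; lra.
Qed.

Lemma S0plusP (i : 'I_n) : i \in S0p -> i \in S0 /\ k%:~R * a s <= a i.
Proof. by rewrite inE => /andP[]. Qed.

Lemma sum_S0plus (F : 'I_n -> R) :
  \sum_(i in S0) F i = \sum_(i in S0p) F i + \sum_(i in S0 :\: S0p) F i.
Proof.
rewrite (big_setID S0p) /= (finset.setIidPr _) //.
by apply/fintype.subsetP => i /S0plusP[].
Qed.

Lemma s_notin_S0plus : s \notin S0p.
Proof. by apply/negP => /S0plusP[]; rewrite (negPf sS0). Qed.

(** The cap [M] on the multiplicity of [s] lets one statement serve both functions: it is [mu s] for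
    [etaL] and is read off the given point for [etaU]. *)
Lemma eta_obj_split (M : int) (u v : R) (x : 'I_n -> int) : u <= 0 -> v <= 0 ->
  k <= M -> (forall i, i \in S0p -> 0 <= x i) -> 0 <= x s <= M ->
  exists x1 x2 : 'I_n -> int,
  [/\ forall i, i \in S0p -> 0 <= x1 i <= x i,
      forall i, i \in S0p -> 0 <= x2 i <= x i,
      0 <= x1 s <= M, 0 <= x2 s <= M &
      eta_obj S0p (u + v) x <= eta_obj S0p u x1 + eta_obj S0p v x2].
Proof.
move=> u0 v0 kM x0 xs; have sS := s_notin_S0plus.
have k1 : 1 <= k by case/andP: k_bounds.
have M0 : 0 <= M - k by lia.
have mM : - k <= x s - k <= M - k by lia.
have [y1 [y2 [m1 [m2 [y1b y2b m1b m2b le]]]]] :=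
  split_items _ _ _ k tilted_g_concave as_gt0 tilted_g0 tilted_gNa k1 (M - k)
    _ S0p a tilted_zeta M0 (fun i iS => proj2 (S0plusP i iS))
    (fun i iS => tilted_zeta_le i (proj2 (S0plusP i iS)))
    u v x (x s - k) u0 v0 x0 mM.
have ne i : i \in S0p -> (i == s) = false.
  by move=> iS; apply: contraNF sS => /eqP is_; rewrite -{1}is_.
exists (fun i => if i == s then m1 + k else y1 i),
  (fun i => if i == s then m2 + k else y2 i); split.
- by move=> i iS; rewrite ne // y1b.
- by move=> i iS; rewrite ne // y2b.
- by rewrite eqxx; lia.
- by rewrite eqxx; lia.
by rewrite !eta_objE // !sum_update_out // !eqxx !addrK; lra.
Qed.

(** Items outside [S0plus] are smaller than [k * a s], hence absorbable at price [tilted_zeta]. The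
    multiplicity of [s] changes to some [j], bounded only below as in [etaU]. *)
Lemma eta_obj_drop_small (d : R) (x : 'I_n -> int) :
  (forall i, i \in S0 -> 0 <= x i) -> 0 <= x s ->
  exists2 j : int, 0 <= j &
    eta_obj S0 d x <= eta_obj S0p d (fun i => if i == s then j else x i).
Proof.
move=> x0 xs0; have sS := s_notin_S0plus.
have k1 : 1 <= k by case/andP: k_bounds.
pose T := S0 :\: S0p.
have TP i : i \in T -> i \in S0 /\ a i < k%:~R * a s.
  by rewrite !inE => /andP[+ iS0]; rewrite iS0 -ltNge.
have absT : absorbable _ tilted_g (a s) k (\sum_(i in T) a i * (x i)%:~R)
    (\sum_(i in T) tilted_zeta i * (x i)%:~R).
  apply: (absorbable_sum _ _ _ _ tilted_g_concave as_gt0 tilted_g0 tilted_gNa k1).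
  - by move=> i /TP[/x0].
  - by move=> i /TP[_ ->]; rewrite a_ge0.
  - by move=> i _ t; exact: tilted_g_le_zeta.
have km : - k <= x s - k by lia.
have [j kj le] := absT (d + \sum_(i in S0p) a i * (x i)%:~R) _ km.
exists (j + k); first by lia.
rewrite !eta_objE // !sum_update_out // eqxx addrK !sum_S0plus -/T.
by rewrite (addrA d); lra.
Qed.

(** Multiplicity [0] for the dropped items turns the pieces of a split back into points admissible
    for [etaU]. *)
Lemma eta_obj_extend0 (d : R) (x : 'I_n -> int) :
  eta_obj S0 d (fun i => if i \in s |: S0p then x i else 0) = eta_obj S0p d x.
Proof.
have sS := s_notin_S0plus; rewrite !eta_objE // setU11.
have E (F : 'I_n -> R) :
    \sum_(i in S0) F i * (if i \in s |: S0p then x i else 0)%:~R =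
    \sum_(i in S0p) F i * (x i)%:~R.
  rewrite sum_S0plus.
  rewrite [X in _ + X]big1 ?addr0 => [|i].
    by apply: eq_bigr => i iS; rewrite setU1r.
  rewrite !inE => /andP[+ iS0]; rewrite iS0 /= => /negPf ->.
  by rewrite orbF (_ : i == s = false) ?mulr0 //; apply: contraNF sS0 => /eqP <-.
by rewrite !E.
Qed.

(** * Subadditivity of [etaL] and [etaU] *)

Lemma etaL_subadditive : subadditive_on [set d : R | d <= 0]%classic
  (etaL f a mu s S0 S1 k).
Proof.
move=> u v /= u0 v0 _.
have [[x /= xb <-] _] := etaLP f a s S0 S1 k mu_ge1 (u + v).
have [_ ubu] := etaLP f a s S0 S1 k mu_ge1 u.
have [_ ubv] := etaLP f a s S0 S1 k mu_ge1 v.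
have x0 i : i \in S0p -> 0 <= x i by move=> iS; case/andP: (xb i (setU1r _ iS)).
have [//|x1 [x2 [x1b x2b x1s x2s le]]] :=
  eta_obj_split _ u v x u0 v0 (proj2 (andP k_bounds)) x0 _.
  exact: xb (setU11 _ _).
have box y : (forall i, i \in S0p -> 0 <= y i <= x i) -> 0 <= y s <= mu s ->
    forall i, i \in s |: S0p -> 0 <= y i <= mu i.
  move=> yb ys i; rewrite in_setU1 => /orP[/eqP->//|iS].
  have := yb i iS; have := xb i (setU1r _ iS).
  by move=> /andP[_ xi] /andP[-> yi]; exact: le_trans yi xi.
apply: (le_trans le); apply: lerD.
  by apply: ubu; exists x1 => //=; exact: box.
by apply: ubv; exists x2 => //=; exact: box.
Qed.

Lemma etaU_subadditive : subadditive_on [set d : R | d <= 0]%classic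
  (etaU f a mu s S0 S1 k).
Proof.
move=> u v /= u0 v0 _.
have etaUP' := etaUP S1 k mu_ge1 f_concave a_ge0 as_gt0 sS0.
have [[x /= [xb xs0] <-] _] := etaUP' (u + v).
have [_ ubu] := etaUP' u; have [_ ubv] := etaUP' v.
have x0 i : i \in S0 -> 0 <= x i by move=> /xb/andP[].
have [j j0 le0] := eta_obj_drop_small (u + v) x x0 xs0.
set x' := fun i => _ in le0.
have ne i : i \in S0 -> (i == s) = false.
  by move=> iS; apply: contraNF sS0 => /eqP <-.
have x'0 i : i \in S0p -> 0 <= x' i.
  by move=> /S0plusP[iS0 _]; rewrite /x' ne // x0.
(* The cap [k + j] is at least [k], as the split requires, and at least [x' s = j]; since [etaU]
   bounds [x s] only below, both pieces remain admissible. *)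
have x's : 0 <= x' s <= k + j by rewrite /x' eqxx; lia.
have kM : k <= k + j by lia.
have [x1 [x2 [x1b x2b x1s x2s le]]] :=
  eta_obj_split _ u v x' u0 v0 kM x'0 x's.
have box y : (forall i, i \in S0p -> 0 <= y i <= x' i) -> 0 <= y s <= k + j ->
    (forall i, i \in S0 ->
       0 <= (if i \in s |: S0p then y i else 0) <= mu i) /\
    0 <= (if s \in s |: S0p then y s else 0).
  move=> yb /andP[ys _]; rewrite setU11; split=> // i iS0.
  rewrite in_setU1 ne //=; case: ifP => iS; last first.
    by rewrite lexx (le_trans _ (mu_ge1 i)).
  have := yb i iS; rewrite /x' ne // => /andP[-> yi] /=.
  by case/andP: (xb i iS0) => _; exact: le_trans.
apply: (le_trans le0); apply: (le_trans le).
rewrite -!eta_obj_extend0; apply: lerD.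
  apply: ubu; exists (fun i => if i \in s |: S0p then x1 i else 0) => //=.
  exact: box.
apply: ubv; exists (fun i => if i \in s |: S0p then x2 i else 0) => //=.
exact: box.
Qed.
End Eta.

Theorem proposition4p12 (R : realType) (n : nat) (hn : (1 <= n)%N)
    (f : R -> R) (hf : concave f)
    (a : 'I_n -> R) (ha : forall i, 0 <= a i)
    (mu : 'I_n -> int) (hmu : forall i, 1 <= mu i)
    (s : 'I_n) (ha_s : 0 < a s)
    (S0 S1 : {set 'I_n})
    (hs0 : s \notin S0) (hs1 : s \notin S1) (hdisj : [disjoint S0 & S1])
    (hcover : (s |: (S0 :|: S1) = [set: 'I_n])%SET)
    (k : int) (hk : 1 <= k <= mu s) :
  subadditive_on [set d : R | d <= 0]%classic (etaL f a mu s S0 S1 k) /\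
  subadditive_on [set d : R | d <= 0]%classic (etaU f a mu s S0 S1 k).
Proof. by split; [exact: etaL_subadditive|exact: etaU_subadditive]. Qed.
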